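(* Let $m,n\ge 1$ and $0\le\kappa\le m$ be integers, let $\mathcal{A}=\{1,2,\dots,m\}$, and let $x_1,\dots,x_m\in\mathbb{R}^n$. Suppose at most $\kappa$ of the vectors are malicious, i.e. the set $\mathcal{M}\subset\mathcal{A}$ of labels of malicious vectors satisfies $|\mathcal{M}|\le\kappa$, and let $\bar{\mathcal{A}}\subset\mathcal{A}\setminus\mathcal{M}$ be a (possibly empty) set of labels of normal vectors with $|\bar{\mathcal{A}}|=\sigma\le p:=m-\kappa$. If $\bar{\mathcal{A}}\neq\emptyset$ or $m\ge\kappa(n+1)+1$, then: (i) the set $\mathcal{R}=\bigcap_{j=1}^{r}\mathcal{H}(x_{\mathcal{A}_j})$ is non-empty, and every point of $\mathcal{R}$ is a resilient convex combination of $x_{\mathcal{A}}$, where $\mathcal{A}_1,\dots,\mathcal{A}_r$ are all the subsets of $\mathcal{A}$ with $\bar{\mathcal{A}}\subset\mathcal{A}_j$ and $|\mathcal{A}_j|=m-\kappa$; (ii) a specific point of $\mathcal{R}$ is obtained from a quadratic program: the problem $$\text{minimize } J(\beta)=\frac1p\Big\|\beta-\frac1p\mathbf{1}_{pr}\Big\|_2^2\quad\text{over }\beta\in\mathbb{R}^{pr}$$ subject to $$(C\otimes I_n)X\beta=0,\qquad (I_r\otimes\mathbf{1}_p')\beta=\mathbf{1}_r,\qquad \beta\ge 0,$$ has a solution $\beta^*$, and the point $$u=\frac1r(\mathbf{1}_r'\otimes I_n)X\beta^*$$ belongs to $\mathcal{R}$.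
   Context: Vectors with labels in $\mathcal{M}$ are called malicious; all other vectors are called normal. For $\mathcal{S}\subset\mathcal{A}$, $x_{\mathcal{S}}$ denotes the family $\{x_i: i\in\mathcal{S}\}$ and $\mathcal{H}(x_{\mathcal{S}})$ its convex hull, i.e. the set of all $\sum_{i\in\mathcal{S}}\alpha_i x_i$ with $\alpha_i\ge0$ and $\sum_{i\in\mathcal{S}}\alpha_i=1$ (empty if $\mathcal{S}=\emptyset$). Resilient convex combination: with $p=m-\kappa$ (a known lower bound on the number of normal vectors), a vector is a resilient convex combination of $x_{\mathcal{A}}$ if it is a convex combination of at least $p$ normal vectors, i.e. it lies in $\mathcal{H}(x_{\mathcal{S}})$ for some $\mathcal{S}\subset\mathcal{A}\setminus\mathcal{M}$ with $|\mathcal{S}|\ge p$ (some coefficients are allowed to be zero). The number of sets $\mathcal{A}_j$ is $r=\binom{m-\sigma}{m-\sigma-\kappa}$. Writing $\mathcal{A}_j=\{j_1,\dots,j_p\}$, put $Y_j=[\,x_{j_1}\ x_{j_2}\ \cdots\ x_{j_p}\,]\in\mathbb{R}^{n\times p}$, and let $X=\mathrm{diag}\{Y_1,\dots,Y_r\}\in\mathbb{R}^{nr\times pr}$ be the block diagonal matrix with these blocks. $C\in\mathbb{R}^{r\times r}$ is the circulant matrix with first row $[1\ -1\ 0\ \cdots\ 0]$, i.e. $(Cz)_j=z_j-z_{j+1}$ with indices modulo $r$ (so $C=0$ if $r=1$). $\mathbf{1}_k\in\mathbb{R}^k$ is the all-ones vector, $I_k$ the $k\times k$ identity matrix, $'$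 denotes transpose, $\otimes$ the Kronecker product, $\|\cdot\|_2$ the 2-norm, and $\beta\ge0$ means entrywise non-negativity. *)

(* Defs.v *)
(* The real field is an arbitrary realType. *)
From mathcomp Require Import all_boot all_order all_algebra.
From mathcomp Require Import mxtens.
From mathcomp Require Import classical_sets reals.

Set Implicit Arguments.
Unset Strict Implicit.
Unset Printing Implicit Defensive.

Import Order.TTheory GRing.Theory Num.Theory.
Local Open Scope ring_scope.

Definition enumerates (T : finType) (k : nat) (f : 'I_k -> T) (S : {set T}) :
    Prop :=
  injective f /\ [set f j | j : 'I_k] = S.

Definition supersets_of_card (T : finType) (B : {set T}) (p : nat) :
    {set {set T}} :=
  [set S : {set T} | (B \subset S) && (#|S| == p)].

Lemma enumerates_exists (T : finType) (S : {set T}) (k : nat) :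
  #|S| = k -> exists f : 'I_k -> T, enumerates f S.
Proof.
move=> <-; exists enum_val; split; first exact: enum_val_inj.
apply/setP=> y; apply/imsetP/idP => [[j _ ->]|yS]; first exact: enum_valP.
by exists (enum_rank_in yS y); rewrite ?enum_rankK_in.
Qed.

(* With T = 'I_m and p = m - kappa this is 'C(m - #|B|, m - #|B| - kappa), so
   enumerations of the family indexed by that binomial exist. *)
Lemma card_supersets_of_card (T : finType) (B : {set T}) (p : nat) :
  (#|B| <= p)%N ->
  #|supersets_of_card B p| = 'C(#|T| - #|B|, p - #|B|).
Proof.
move=> leBp; set D := [set E : {set T} | E \subset ~: B & #|E| == (p - #|B|)%N].
have -> : supersets_of_card B p = [set B :|: E | E in D].
  apply/setP=> S; rewrite inE; apply/andP/imsetP => [[sBS /eqP cS]|[E]].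
    exists (S :\: B).
      by rewrite inE finset.setDE finset.subsetIr -finset.setDE cardsDS ?cS /=.
    by rewrite -{1}(finset.setID S B) (finset.setIidPr sBS).
  rewrite inE => /andP[sE /eqP cE] ->; rewrite finset.subsetUl; split=> //.
  rewrite cardsU cE disjoint_setI0 ?cards0 ?subn0 ?subnKC //.
  by rewrite disjoint_sym finset.disjoints_subset.
rewrite card_in_imset; first by rewrite cards_draws cardsCs finset.setCK.
have UK (E : {set T}) : E \in D -> (B :|: E) :\: B = E.
  rewrite inE -finset.disjoints_subset => /andP[dE _].
  by rewrite finset.setDUl finset.setDv finset.set0U; apply/finset.setDidPl.
by move=> E1 E2 hE1 hE2 eqU; rewrite -(UK _ hE1) eqU UK.
Qed.

Definition hull (R : realType) (m n : nat) (x : 'I_m -> 'cV[R]_n)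
    (S : {set 'I_m}) : set 'cV[R]_n :=
  [set y | exists alpha : 'I_m -> R,
     [/\ forall i, i \in S -> 0 <= alpha i,
         \sum_(i in S) alpha i = 1 &
         y = \sum_(i in S) alpha i *: x i]]%classic.

(* M is the set of labels of the malicious vectors and p the known lower bound
   on the number of normal ones. *)
Definition resilient_convex_combination (R : realType) (m n : nat)
    (x : 'I_m -> 'cV[R]_n) (M : {set 'I_m}) (p : nat) (y : 'cV[R]_n) : Prop :=
  exists S : {set 'I_m}, [/\ S \subset ~: M, (p <= #|S|)%N & hull x S y].

Definition common_hull (R : realType) (m n : nat) (x : 'I_m -> 'cV[R]_n)
    (r : nat) (A : 'I_r -> {set 'I_m}) : set 'cV[R]_n :=
  (\bigcap_(j in [set: 'I_r]) hull x (A j))%classic.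

Definition norm2 (R : realType) (k : nat) (v : 'cV[R]_k) : R :=
  Num.sqrt (\sum_i v i 0 ^+ 2).

(* ordS is the cyclic successor, so C = 0 when r = 1. *)
Definition circulant_diff (R : realType) (r : nat) : 'M[R]_r :=
  \matrix_(j, k) ((k == j)%:R - (k == ordS j)%:R).

(* Rows and columns are indexed as in the Kronecker product *t: the block
   index comes first. *)
Definition block_diag (R : realType) (r n p : nat) (Y : 'I_r -> 'M[R]_(n, p)) :
    'M[R]_(r * n, r * p) :=
  \matrix_(a, b)
    if (mxtens_unindex a).1 == (mxtens_unindex b).1
    then Y (mxtens_unindex a).1 (mxtens_unindex a).2 (mxtens_unindex b).2
    else 0.

(* lab j k is the k-th label of the j-th set; column k of Y_j is x (lab j k). *)
Definition stackedY (R : realType) (m n r p : nat) (x : 'I_m -> 'cV[R]_n)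
    (lab : 'I_r -> 'I_p -> 'I_m) (j : 'I_r) : 'M[R]_(n, p) :=
  \matrix_(i < n, k < p) x (lab j k) i 0.

Definition stackedX (R : realType) (m n r p : nat) (x : 'I_m -> 'cV[R]_n)
    (lab : 'I_r -> 'I_p -> 'I_m) :
    'M[R]_(r * n, r * p) := block_diag (stackedY x lab).

Definition qp_cost (R : realType) (r p : nat) (beta : 'cV[R]_(r * p)) : R :=
  p%:R^-1 * norm2 (beta - p%:R^-1 *: const_mx 1) ^+ 2.

Definition qp_feasible (R : realType) (m n r p : nat) (x : 'I_m -> 'cV[R]_n)
    (lab : 'I_r -> 'I_p -> 'I_m) (beta : 'cV[R]_(r * p)) : Prop :=
  [/\ (circulant_diff R r *t (1%:M : 'M_n)) *m stackedX x lab *m beta = 0,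
      ((1%:M : 'M_r) *t (const_mx 1 : 'rV_p)) *m beta = const_mx 1 &
      forall a, 0 <= beta a 0].

Definition qp_solution (R : realType) (m n r p : nat) (x : 'I_m -> 'cV[R]_n)
    (lab : 'I_r -> 'I_p -> 'I_m) (beta : 'cV[R]_(r * p)) : Prop :=
  qp_feasible x lab beta /\
  forall gamma, qp_feasible x lab gamma -> qp_cost beta <= qp_cost gamma.

(* The cast only identifies 1 * n with n. *)
Definition qp_point (R : realType) (m n r p : nat) (x : 'I_m -> 'cV[R]_n)
    (lab : 'I_r -> 'I_p -> 'I_m) (beta : 'cV[R]_(r * p)) : 'cV[R]_n :=
  r%:R^-1 *: castmx (mul1n n, erefl 1%N)
    (((const_mx 1 : 'rV_r) *t (1%:M : 'M_n)) *m stackedX x lab *m beta).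

(* Main.v *)
(** Every intersection point of the hulls is resilient because one of the sets
    [A_j] avoids all malicious labels. The intersection is non-empty by Helly's
    theorem: any [n+1] of the sets omit at most [kappa(n+1) < m] labels
    altogether, hence share a label. The constraints of the quadratic program
    say that the blocks of [beta] are convex weights for the families
    [x_{A_j}] and that the resulting combinations agree for all [j]; so the
    feasible set is a non-empty compact polytope, the continuous cost attains
    its minimum on it, and [u], the average of [r] equal points, is the common
    value. *)
Require Import Defs.
From mathcomp Require Import all_boot all_order all_algebra.
From mathcomp Require Import mxtens zify.
From mathcomp Require Import boolp classical_sets reals.
From mathcomp Require Import topology normedtype function_spaces derive.

Set Implicit Arguments.
Unset Strict Implicit.
Unset Printing Implicit Defensive.

Import Order.TTheory GRing.Theory Num.Theory numFieldNormedType.Exports.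
Local Open Scope ring_scope.

(** * Convexity and Helly's theorem *)

(** Convexity stated for finite families instead of pairs, the form in which Radon's point and the
    block combinations use it. *)
Definition combination_closed (R : realType) (V : lmodType R) (F : set V) :=
  forall (J : finType) (P : {set J}) (c : J -> R) (z : J -> V),
    (forall j, j \in P -> 0 <= c j) -> \sum_(j in P) c j = 1 ->
    (forall j, j \in P -> F (z j)) -> F (\sum_(j in P) c j *: z j).

Lemma hull_combination_closed (R : realType) m n (x : 'I_m -> 'cV[R]_n)
    (S : {set 'I_m}) : combination_closed (hull x S).
Proof.
move=> J P c z c0 c1 zS.
have /fin_all_exists[a Ha] : forall j, exists a : 'I_m -> R, j \in P ->
   [/\ forall i, i \in S -> 0 <= a i, \sum_(i in S) a i = 1 &
         z j = \sum_(i in S) a i *: x i].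
  move=> j; case: (boolP (j \in P)) => [/zS[a Ha]|_]; first by exists a.
  by exists (fun=> 0).
exists (fun i => \sum_(j in P) c j * a j i); split.
- move=> i iS; apply: sumr_ge0 => j jP; rewrite mulr_ge0 ?c0//.
  by have [+ _ _] := Ha j jP; apply.
- rewrite exchange_big -[RHS]c1; apply: eq_bigr => j jP /=.
  by rewrite -mulr_sumr; have [_ -> _] := Ha j jP; rewrite mulr1.
- under [RHS]eq_bigr do rewrite scaler_suml.
  rewrite exchange_big; apply: eq_bigr => j jP /=.
  have [_ _ ->] := Ha j jP; rewrite scaler_sumr.
  by apply: eq_bigr => i _; rewrite scalerA.
Qed.

Lemma mem_hull (R : realType) m n (x : 'I_m -> 'cV[R]_n) (S : {set 'I_m}) i :
  i \in S -> hull x S (x i).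
Proof.
move=> iS; exists (fun k => (k == i)%:R); split.
- by move=> k _; rewrite ler0n.
- by rewrite (bigD1 i) //= eqxx big1 ?addr0 // => k /andP[_ /negbTE ->].
- rewrite (bigD1 i) //= eqxx scale1r big1 ?addr0 // => k /andP[_ /negbTE ->].
  by rewrite scale0r.
Qed.

(** Append a coordinate 1 to each vector: more than [n + 1] rows of length [n + 1] have a non-zero
    left kernel vector, and the extra column forces its entries to sum to zero. *)
Lemma affine_dependence (R : fieldType) (I : finType) n (z : I -> 'cV[R]_n)
    (J : {set I}) : (n.+1 < #|J|)%N ->
  exists c : I -> R, [/\ exists2 i, i \in J & c i != 0,
    \sum_(i in J) c i = 0 & \sum_(i in J) c i *: z i = 0].
Proof.
move=> ltnJ; have /card_gt0P[i0 i0J] : (0 < #|J|)%N by lia.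
pose A : 'M[R]_(#|J|, n + 1) := \matrix_(k < #|J|) row_mx (z (enum_val k))^T 1.
have : kermx A != 0.
  rewrite kermx_eq0; apply: contraL ltnJ => /eqP <-.
  by rewrite -leqNgt; apply: leq_trans (rank_leq_col A) _; rewrite addn1.
case/rowV0Pn=> v /sub_kermxP vA0 v0; exists (fun i => v 0 (enum_rank_in i0J i)).
have coef0 j : \sum_k v 0 k * A k j = 0.
  by have /rowP/(_ j) := vA0; rewrite !mxE.
split.
- case/rV0Pn: v0 => k vk; exists (enum_val k); first exact: enum_valP.
  by rewrite enum_valK_in.
- rewrite big_enum_val -[RHS](coef0 (rshift n 0)); apply: eq_bigr => k _.
  by rewrite enum_valK_in mxE row_mxEr mxE mulr1.
- rewrite big_enum_val; apply/colP => i; rewrite summxE mxE.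
  rewrite -[RHS](coef0 (lshift 1 i)); apply: eq_bigr => k _.
  by rewrite enum_valK_in !mxE (unsplitK (inl i)) mxE.
Qed.

(* Radon's argument: with z_i common to all the sets but the i-th, split an
   affine dependence of the z_i by sign; the two halves represent the same
   point, once by the z_i with i in Pos and once by those with i outside. *)
Lemma helly (R : realType) (I : finType) n (F : I -> set 'cV[R]_n) :
  (forall i, combination_closed (F i)) ->
  (forall J : {set I}, (#|J| <= n.+1)%N ->
     exists y, forall i, i \in J -> F i y) ->
  forall J : {set I}, exists y, forall i, i \in J -> F i y.
Proof.
(* Induction on the cardinality with [J] generalised, so that the hypothesis applies to every
   [J :\ i]. *)
move=> Fconv small J; move: {2}#|J| (erefl #|J|) => k.
elim: k J => [|k IH] J cJ; first by apply: small; rewrite cJ.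
case: (leqP #|J| n.+1) => [|ltnJ]; first exact: small.
have /fin_all_exists[z Hz] : forall i, exists y, i \in J ->
    forall j, j \in J -> j != i -> F j y.
  move=> i; case: (boolP (i \in J)) => [iJ|_]; last by exists 0.
  have [|y Hy] := IH (J :\ i); first by have := cardsD1 i J; rewrite iJ; lia.
  by exists y => _ j jJ ji; apply: Hy; rewrite in_setD1 ji.
have [c [[i0 i0J ci0] c0 cz0]] := affine_dependence z ltnJ.
pose Pos := [set i | 0 < c i].
pose s := \sum_(i in J :&: Pos) c i.
have sN : s = \sum_(i in J :\: Pos) - c i.
  by move: c0; rewrite (big_setID Pos) /= sumrN => /addr0_eq <-; rewrite opprK.
have posP i : i \in J :&: Pos -> 0 <= c i.
  by rewrite !inE => /andP[_ /ltW].
have negP i : i \in J :\: Pos -> 0 <= - c i.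
  by rewrite !inE -leNgt oppr_ge0 => /andP[].
have s_gt0 : 0 < s.
  (* If [s] vanished, both halves would be sums of non-negative terms equal to zero, so every term,
     [c i0] included, would vanish. *)
  rewrite lt_def sumr_ge0 // andbT; apply: contra_neq ci0 => s0.
  case: (boolP (i0 \in Pos)) => iPos.
    by apply: (psumr_eq0P posP s0); rewrite inE i0J.
  apply: oppr_inj; rewrite oppr0.
  by apply: (psumr_eq0P negP) => //; rewrite -?sN // inE iPos.
pose w := \sum_(i in J :&: Pos) (c i / s) *: z i.
have wN : w = \sum_(i in J :\: Pos) (- c i / s) *: z i.
  apply/eqP; rewrite -subr_eq0; apply/eqP.
  under [X in _ - X]eq_bigr do rewrite mulNr scaleNr.
  rewrite sumrN opprK -big_setID /=.
  under eq_bigr do rewrite mulrC -scalerA.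
  by rewrite -scaler_sumr cz0 scaler0.
(* To land in [F j], use the half whose index set does not contain [j]: each of its [z i] has
   [i != j] and so lies in [F j]. *)
exists w => j jJ; case: (boolP (j \in Pos)) => jPos.
  rewrite wN; apply: Fconv => [i iP||i iP].
  - by rewrite divr_ge0 ?negP // ltW.
  - by rewrite -mulr_suml -sN divff ?gt_eqF.
  - move: iP; rewrite inE => /andP[iPos iJ]; apply: Hz => //.
    by apply: contraNneq iPos => <-.
apply: Fconv => [i iP||i iP].
- by rewrite divr_ge0 ?posP // ltW.
- by rewrite -mulr_suml divff ?gt_eqF.
- move: iP; rewrite inE => /andP[iJ iPos]; apply: Hz => //.
  by apply: contraNneq jPos => ->.
Qed.

Lemma common_hull_nonempty (R : realType) m n kappa r (x : 'I_m -> 'cV[R]_n)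
    (A : 'I_r -> {set 'I_m}) :
  (forall j, #|~: A j| <= kappa)%N -> (kappa * (n + 1) + 1 <= m)%N ->
  exists y, common_hull x A y.
Proof.
move=> cA mk.
have [|J cJ|y Hy] := @helly R 'I_r n (fun j => hull x (A j)) _ _ finset.setT.
- by move=> j; apply: hull_combination_closed.
(* Without a shared label the complements of the [A j] would cover all [m] labels, although together
   they hold at most [kappa * (n + 1)]. *)
- have [i iJ] : exists i, i \notin \bigcup_(j in J) ~: A j.
    apply/existsP; rewrite -[[exists i, _]]negbK negb_exists.
    apply/negP => /forallP all_i.
    have : (m <= \sum_(j in J) kappa)%N.
      apply: (@leq_trans (\sum_(j in J) #|~: A j|)); last exact: leq_sum.
      apply: (@leq_trans #|\bigcup_(j in J) ~: A j|).
        rewrite -[X in (X <= _)%N]card_ord.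
        apply/subset_leq_card/fintype.subsetP => i _.
        by have := all_i i; rewrite negbK.
      elim/big_rec2: _ => [|j a B _ leBa]; first by rewrite cards0.
      by rewrite cardsU; lia.
    by rewrite sum_nat_const; nia.
  exists (x i) => j jJ; apply: mem_hull; apply: contraNT iJ => iA.
  by apply/bigcupP; exists j => //; rewrite inE.
by exists y => j _; apply: Hy; rewrite inE.
Qed.

(** * Kronecker indexing and the meaning of the constraints *)

Lemma sum_mxtens_index (V : nmodType) m n (F : 'I_(m * n) -> V) :
  \sum_a F a = \sum_i \sum_j F (mxtens_index (i, j)).
Proof.
rewrite pair_bigA /= (reindex (@mxtens_index m n)) /=.
  by apply: eq_bigr => -[].
by exists (@mxtens_unindex m n) => ? _; rewrite ?mxtens_indexK ?mxtens_unindexK.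
Qed.

(** The bridge from matrices to geometry: the entries of [stackedX x lab *m beta] are the
    coordinates of these points. *)
Definition block_comb (R : realType) (m n r p : nat) (x : 'I_m -> 'cV[R]_n)
    (lab : 'I_r -> 'I_p -> 'I_m) (beta : 'cV[R]_(r * p)) (j : 'I_r) :=
  \sum_k beta (mxtens_index (j, k)) 0 *: x (lab j k).

Lemma stackedX_mul (R : realType) m n r p (x : 'I_m -> 'cV[R]_n)
    (lab : 'I_r -> 'I_p -> 'I_m) beta j i :
  (stackedX x lab *m beta) (mxtens_index (j, i)) 0 =
  block_comb x lab beta j i 0.
Proof.
rewrite mxE sum_mxtens_index (bigD1 j) //= [X in _ + X]big1 ?addr0.
  rewrite /block_comb summxE; apply: eq_bigr => k _.
  by rewrite !mxE !mxtens_indexK /= eqxx mulrC.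
move=> j' /negbTE nj; apply: big1 => k _.
by rewrite mxE !mxtens_indexK /= eq_sym nj mul0r.
Qed.

Lemma sum_deltal (R : pzRingType) (I : finType) (i : I) (F : I -> R) :
  \sum_k (k == i)%:R * F k = F i.
Proof.
rewrite (bigD1 i) //= eqxx mul1r big1 ?addr0 // => k /negbTE ->.
by rewrite mul0r.
Qed.

Lemma tens_id_mul (R : realType) r s n (C : 'M[R]_(s, r)) (w : 'cV[R]_(r * n))
    j i :
  ((C *t (1%:M : 'M_n)) *m w) (mxtens_index (j, i)) 0 =
  \sum_l C j l * w (mxtens_index (l, i)) 0.
Proof.
rewrite mxE sum_mxtens_index; apply: eq_bigr => l _.
rewrite (bigD1 i) //= big1 ?addr0 => [|k /negbTE nk].
  by rewrite tensmxE mxE eqxx mulr1.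
by rewrite tensmxE mxE eq_sym nk mulr0 mul0r.
Qed.

Lemma id_tens_ones_mul (R : realType) r p (beta : 'cV[R]_(r * p)) j :
  (((1%:M : 'M_r) *t (const_mx 1 : 'rV_p)) *m beta) (mxtens_index (j, ord0)) 0 =
  \sum_k beta (mxtens_index (j, k)) 0.
Proof.
rewrite mxE sum_mxtens_index (bigD1 j) //=.
rewrite [X in _ + X]big1 ?addr0 => [|l /negbTE nl].
  by apply: eq_bigr => k _; rewrite tensmxE !mxE eqxx !mul1r.
by apply: big1 => k _; rewrite tensmxE !mxE eq_sym nl !mul0r.
Qed.

(** Every index is reached from 0 by successors that do not wrap around, so all values agree with
    the one at 0. *)
Lemma ordS_invariant (T : Type) r (f : 'I_r -> T) :
  (forall j, f j = f (ordS j)) -> forall i j, f i = f j.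
Proof.
case: r f => [|r] f fS; first by case.
suff f0 k (ltk : (k < r.+1)%N) : f (Ordinal ltk) = f ord0.
  by move=> [i hi] [j hj]; rewrite !f0.
elim: k ltk => [|k IH] ltk; first by congr f; apply: val_inj.
rewrite -(IH (ltnW ltk)) [RHS]fS; congr f; apply: val_inj => /=.
by rewrite modn_small.
Qed.

(** Each block row of the circulant constraint subtracts the points of two cyclically consecutive
    blocks; chaining these equalities identifies all the points. *)
Lemma qp_feasibleP (R : realType) m n r p (x : 'I_m -> 'cV[R]_n)
    (lab : 'I_r -> 'I_p -> 'I_m) beta :
  qp_feasible x lab beta <->
  [/\ forall i j, block_comb x lab beta i = block_comb x lab beta j,
      forall j, \sum_k beta (mxtens_index (j, k)) 0 = 1 &
      forall a, 0 <= beta a 0].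
Proof.
have CE j i : ((circulant_diff R r *t (1%:M : 'M_n)) *m stackedX x lab *m beta)
    (mxtens_index (j, i)) 0 =
    block_comb x lab beta j i 0 - block_comb x lab beta (ordS j) i 0.
  rewrite -mulmxA tens_id_mul; under eq_bigr do
    rewrite stackedX_mul [circulant_diff _ _ _ _]mxE mulrBl.
  by rewrite sumrB !sum_deltal.
split=> -[]; last first.
  move=> eqb sum1 b0; split=> //.
    apply/colP => a; rewrite -[a]mxtens_unindexK; case: mxtens_unindex => j i.
    by rewrite CE (eqb j (ordS j)) subrr mxE.
  apply/colP => a; rewrite -[a]mxtens_unindexK; case: mxtens_unindex => j i.
  by rewrite [i]ord1 id_tens_ones_mul sum1 mxE.
move=> C0 S1 b0; split=> //.
  apply: ordS_invariant => j; apply/colP => i; apply/eqP.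
  by rewrite -subr_eq0 -CE C0 mxE.
by move=> j; rewrite -id_tens_ones_mul S1 mxE.
Qed.

Lemma qp_point_block_comb (R : realType) m n r p (x : 'I_m -> 'cV[R]_n)
    (lab : 'I_r -> 'I_p -> 'I_m) beta j :
  qp_feasible x lab beta -> qp_point x lab beta = block_comb x lab beta j.
Proof.
case/qp_feasibleP => eqb _ _; apply/colP => i; rewrite mxE castmxE /=.
(* With a single block row, the flat position [i] is the pair [(0, i)], which lets [tens_id_mul]
   apply. *)
have -> : cast_ord (esym (mul1n n)) i = mxtens_index (ord0 : 'I_1, i).
  by apply: val_inj.
rewrite cast_ord_id -mulmxA tens_id_mul.
under eq_bigr do rewrite stackedX_mul mxE mul1r (eqb _ j).
(* The sum has [r] equal terms, and [r] is non-zero because [j] inhabits ['I_r]. *)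
rewrite sumr_const card_ord -[X in _ * X]mulr_natl mulKf // pnatr_eq0.
by rewrite -lt0n (leq_ltn_trans (leq0n j)) // ltn_ord.
Qed.

Lemma sum_enumerates (V : nmodType) (T : finType) k (f : 'I_k -> T) S
    (F : T -> V) : enumerates f S -> \sum_(i in S) F i = \sum_j F (f j).
Proof.
case=> finj <-; rewrite big_imset /=; first exact: eq_bigl.
by move=> ? ? _ _; apply: finj.
Qed.

Lemma block_comb_hull (R : realType) m n r p (x : 'I_m -> 'cV[R]_n)
    (lab : 'I_r -> 'I_p -> 'I_m) (A : 'I_r -> {set 'I_m}) beta j :
  enumerates (lab j) (A j) -> qp_feasible x lab beta ->
  hull x (A j) (block_comb x lab beta j).
Proof.
move=> [_ labA] /qp_feasibleP[_ sum1 b0].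
(* The vertices are indexed by position [k] rather than by label, so the block weights serve as they
   stand. *)
have := @hull_combination_closed R m n x (A j) 'I_p finset.setT
  (fun k => beta (mxtens_index (j, k)) 0) (x \o lab j).
rewrite !(eq_bigl _ _ (@finset.in_setT _)).
apply=> [k _|//|k _]; first exact: b0.
by apply: mem_hull; rewrite -labA; apply: imset_f.
Qed.

(** A common point has convex weights over each [A j]; read along [lab j] they form block [j], and
    all blocks then represent that same point. *)
Lemma qp_feasible_nonempty (R : realType) m n r p (x : 'I_m -> 'cV[R]_n)
    (lab : 'I_r -> 'I_p -> 'I_m) (A : 'I_r -> {set 'I_m}) :
  (forall j, enumerates (lab j) (A j)) ->
  (exists y, common_hull x A y) -> exists beta, qp_feasible x lab beta.
Proof.
move=> labA [y Hy].
have /fin_all_exists[a Ha] : forall j, exists a : 'I_m -> R,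
    [/\ forall i, i \in A j -> 0 <= a i, \sum_(i in A j) a i = 1 &
         y = \sum_(i in A j) a i *: x i].
  by move=> j; apply: Hy.
pose beta := \col_(b < r * p)
  a (mxtens_unindex b).1 (lab (mxtens_unindex b).1 (mxtens_unindex b).2).
have betaE j k : beta (mxtens_index (j, k)) 0 = a j (lab j k).
  by rewrite mxE mxtens_indexK.
have combE j : block_comb x lab beta j = y.
  have [_ _ ->] := Ha j; rewrite (sum_enumerates _ (labA j)).
  by apply: eq_bigr => k _; rewrite betaE.
exists beta; apply/qp_feasibleP; split.
- by move=> i j; rewrite !combE.
- move=> j; have [_ <- _] := Ha j; rewrite (sum_enumerates _ (labA j)).
  by apply: eq_bigr => k _; rewrite betaE.
- move=> b; rewrite -[b]mxtens_unindexK; case: mxtens_unindex => j k.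
  rewrite betaE; have [a_ge0 _ _] := Ha j; apply: a_ge0.
  by case: (labA j) => _ <-; apply: imset_f.
Qed.

(** * Continuity, compactness and the minimum *)

Lemma continuous_sum_ord (R : realType) (T : topologicalType) k
    (f : 'I_k -> T -> R) :
  (forall i, continuous (f i)) -> continuous (fun v => \sum_i f i v).
Proof.
by move=> fc; apply: continuous_big => //; apply: add_continuous.
Qed.

(* [rV_compact] is about row vectors, hence the transposes from here on. *)
Lemma continuous_linear_form (R : realType) k l (E : 'M[R]_(l, k)) i :
  continuous (fun v : 'rV[R]_k => (E *m v^T) i 0).
Proof.
have -> : (fun v : 'rV[R]_k => (E *m v^T) i 0) =
    (fun v => \sum_j E i j * v 0 j).
  by apply/funext => v; rewrite mxE; apply: eq_bigr => j _; rewrite mxE.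
apply: continuous_sum_ord => j v.
by apply: continuousM; [exact: cst_continuous|exact: coord_continuous].
Qed.

Lemma closed_affine (R : realType) k l (E : 'M[R]_(l, k)) b :
  closed [set v : 'rV[R]_k | E *m v^T = b]%classic.
Proof.
have -> : [set v : 'rV[R]_k | E *m v^T = b]%classic =
    (\bigcap_(i in [set: 'I_l])
       ((fun v : 'rV[R]_k => (E *m v^T) i 0) @^-1`
          [set y | y = b i 0]))%classic.
  apply/seteqP; split=> [v /= <- i _ //|v /= Ev].
  by apply/colP => i; apply: Ev.
apply: closed_bigI => i _.
apply: (continuous_closedP _).1; last exact: closed_eq.
exact: continuous_linear_form.
Qed.

Lemma continuous_qp_cost (R : realType) r p :
  continuous (fun v : 'rV[R]_(r * p) => qp_cost v^T).
Proof.
(* Squaring cancels the root in the norm, which leaves a polynomial in the entries. *)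
have -> : (fun v : 'rV[R]_(r * p) => qp_cost v^T) =
    (fun v => p%:R^-1 * \sum_a (v 0 a - p%:R^-1) ^+ 2).
  apply/funext => v; rewrite /qp_cost /norm2 sqr_sqrtr.
    by congr (_ * _); apply: eq_bigr => a _; rewrite !mxE mulr1.
  by apply: sumr_ge0 => a _; apply: sqr_ge0.
move=> v.
apply: (@continuousM _ _ (fun=> _)
  (fun v : 'rV[R]_(r * p) => \sum_a (v 0 a - p%:R^-1) ^+ 2)).
  exact: cst_continuous.
apply: continuous_sum_ord => a w.
have c1 : {for w, continuous (fun u : 'rV[R]_(r * p) => u 0 a - p%:R^-1)}.
  by apply: continuousB; [exact: coord_continuous|exact: cst_continuous].
exact: (continuousM c1 c1).
Qed.

(** Non-negative entries summing to 1 within a block are each at most 1, so closed affine conditions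
    cut the feasible set out of the unit cube. *)
Lemma compact_qp_feasible (R : realType) m n r p (x : 'I_m -> 'cV[R]_n)
    (lab : 'I_r -> 'I_p -> 'I_m) :
  compact [set v : 'rV[R]_(r * p) | qp_feasible x lab v^T]%classic.
Proof.
pose box := [set v : 'rV[R]_(r * p) |
  forall a, `[0%R, 1%R]%classic (v ord0 a)]%classic.
have cbox : compact box.
  apply: (@rV_compact R _ (fun=> `[0%R, 1%R]%classic)) => a.
  exact: segment_compact.
pose E1 := (circulant_diff R r *t (1%:M : 'M_n)) *m stackedX x lab.
pose E2 : 'M[R]_(r * 1, r * p) := (1%:M : 'M_r) *t (const_mx 1 : 'rV_p).
have -> : [set v : 'rV[R]_(r * p) | qp_feasible x lab v^T]%classic =
  (box `&` [set v | E1 *m v^T = 0%R]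
   `&` [set v | E2 *m v^T = const_mx 1%R])%classic.
  apply/seteqP; split=> v /=; last first.
    move=> [[vbox E1v E2v]]; split=> // a.
    by rewrite mxE; have := vbox a; rewrite /= in_itv /= => /andP[].
  move=> Fv; have [E1v E2v v0] := Fv; split; first split => // a.
  have [_ sum1 _] := (qp_feasibleP _ _ _).1 Fv.
  rewrite /= in_itv /=; have := v0 a; rewrite mxE => -> /=.
  rewrite -[a]mxtens_unindexK; case: mxtens_unindex => j k.
  rewrite -(sum1 j) (bigD1 k) //= mxE lerDl; apply: sumr_ge0 => k' _; exact: v0.
  exact: E2v.
apply: (subclosed_compact _ cbox); last by move=> v [[]].
apply: closedI; last exact: closed_affine.
apply: closedI; last exact: closed_affine.
exact: (compact_closed _ cbox).
Qed.

Lemma qp_solution_exists (R : realType) m n r p (x : 'I_m -> 'cV[R]_n)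
    (lab : 'I_r -> 'I_p -> 'I_m) :
  (exists beta, qp_feasible x lab beta) -> exists beta, qp_solution x lab beta.
Proof.
move=> [b0 Fb0].
have [|v vF vmin] := compact_EVT_min _ (@compact_qp_feasible R m n r p x lab)
  (continuous_subspaceT (@continuous_qp_cost R r p)).
  by exists b0^T; rewrite /= trmxK.
move: vF; rewrite inE => /= Fv; exists v^T; split=> // g Fg.
by have := vmin g^T; rewrite inE /= trmxK; apply.
Qed.

(** * Sets of normal labels and the conclusion *)

(** Enlarge [B] by [p - #|B|] elements of [D :\: B]; positivity of a binomial coefficient says that
    there are enough. With [D] the normal labels this yields the [A j] free of malicious ones. *)
Lemma exists_intermediate_set (T : finType) (B D : {set T}) p :
  B \subset D -> (#|B| <= p <= #|D|)%N ->
  exists S : {set T}, [/\ B \subset S, S \subset D & #|S| = p].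
Proof.
move=> sBD /andP[leBp lepD].
have : (0 < #|[set E : {set T} | E \subset D :\: B & #|E| == (p - #|B|)%N]|)%N.
  by rewrite cards_draws bin_gt0 cardsDS // leq_sub2r.
case/card_gt0P=> E; rewrite inE finset.subsetD => /andP[/andP[sED dEB] /eqP cE].
exists (B :|: E); split; first exact: finset.subsetUl.
  by rewrite finset.subUset sBD.
by rewrite cardsU finset.setIC disjoint_setI0 // cards0 cE; lia.
Qed.

Theorem theorem1 (R : realType) (m n kappa sigma p r : nat)
    (hm : (1 <= m)%N) (hn : (1 <= n)%N) (hkappa : (kappa <= m)%N)
    (x : 'I_m -> 'cV[R]_n)
    (M : {set 'I_m}) (hM : (#|M| <= kappa)%N)
    (hp : p = (m - kappa)%N)
    (Abar : {set 'I_m}) (hAbar : Abar \subset ~: M)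
    (hsigma : #|Abar| = sigma) (hsigmap : (sigma <= p)%N)
    (hcond : Abar != finset.set0 \/ (kappa * (n + 1) + 1 <= m)%N)
    (hr : r = 'C(m - sigma, m - sigma - kappa))
    (A : 'I_r -> {set 'I_m})
    (hA : enumerates A (supersets_of_card Abar p)) :
  ((exists y, common_hull x A y) /\
   (forall y, common_hull x A y -> resilient_convex_combination x M p y)) /\
  (forall lab : 'I_r -> 'I_p -> 'I_m,
     (forall j, enumerates (lab j) (A j)) ->
     (exists beta, qp_solution x lab beta) /\
     (forall beta, qp_solution x lab beta ->
        common_hull x A (qp_point x lab beta))).
Proof.
case: hA => _ imA.
have AP j : Abar \subset A j /\ #|A j| = p.
  have : A j \in supersets_of_card Abar p by rewrite -imA; apply: imset_f.
  by rewrite inE => /andP[-> /eqP].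
have R_neq0 : exists y, common_hull x A y.
  (* A label in [Abar] belongs to every [A j], so its vector is a common point. In the other case
     Helly applies, each [A j] omitting [m - p = kappa] labels. *)
  case: hcond => [/finset.set0Pn[i iA]|mk].
    exists (x i) => j _; apply: mem_hull.
    by have [/fintype.subsetP+ _] := AP j; apply.
  apply: common_hull_nonempty mk => j.
  by have := cardsC (A j); rewrite (AP j).2 card_ord; lia.
split; first (split=> // y Hy).
  have cM : (p <= #|~: M|)%N by have := cardsC M; rewrite card_ord; lia.
  have [|S [sAS sSM cS]] := @exists_intermediate_set _ Abar (~: M) p hAbar.
    by rewrite hsigma hsigmap.
  (* [S] is therefore one of the enumerated sets, and a common point lies in its hull. *)
  have : S \in supersets_of_card Abar p by rewrite inE sAS cS eqxx.
  rewrite -imA => /imsetP[j _ SA]; exists S; split; rewrite ?cS //.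
  by rewrite SA; apply: Hy.
move=> lab labA; split.
  exact: qp_solution_exists (qp_feasible_nonempty labA R_neq0).
move=> beta [Fbeta _] j _; rewrite (qp_point_block_comb j Fbeta).
exact: block_comb_hull.
Qed.
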